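(* There is a constant $c$ such that for every $n\in\mathbb{N}_{\ge1}$ there exists a language $L_n$ recognized by a non-deterministic weak Muller automaton $\mathfrak{A}_n$ with Emerson–Lei acceptance condition, of size at most $c\cdot n^3$, such that Player $O$ wins $\Gamma_f(L_n)$ for some constant delay function $f$, but Player $I$ wins $\Gamma_g(L_n)$ for every delay function $g$ with $\sum_{i=0}^{(n+2)\cdot 2^n}g(i)\le 2^{2^{2^n}}$.
   Context: An $\omega$-automaton $\mathfrak{A}=(Q,\Sigma,q_I,\Delta,\mathrm{Acc})$ has finite state set $Q$, alphabet $\Sigma$, initial state $q_I$, transitions $\Delta\subseteq Q\times\Sigma\times Q$, accepting runs $\mathrm{Acc}\subseteq\Delta^\omega$; $L(\mathfrak{A})$ is the set of words processed by some initial accepting run (runs $(q_0,a_0,q_1)(q_1,a_1,q_2)\cdots$ with $q_0=q_I$ processing $a_0a_1\cdots$). A weak Muller automaton has $\mathcal{F}\subseteq 2^Q$ and accepts runs whose set of visited states lies in $\mathcal{F}$. Emerson–Lei representation: $\mathcal{F}$ is given by a Boolean formula $\varphi$ over variables $Q$, $\mathcal{F}$ being the sets $F\subseteq Q$ such that the assignment making exactly the elements of $F$ true satisfies $\varphi$; the size of the automaton is $|Q|+|\varphi|$. A delay function is $f:\mathbb{N}\to\mathbb{N}_{\ge1}$; it is constant if $f(i)=1$ for all $i>0$. In the delay game $\Gamma_f(L)$, $L\subseteq(\Sigma_I\times\Sigma_O)^\omega$, in round $i=0,1,\dots$ Player $I$ picks $u_i\in\Sigma_I^{f(i)}$ and then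 Player $O$ picks $v_i\in\Sigma_O$; $O$ wins the play iff $\binom{u_0u_1\cdots}{v_0v_1\cdots}\in L$. Strategies: $\tau_I:\Sigma_O^*\to\Sigma_I^*$ with $|\tau_I(w)|=f(|w|)$, $\tau_O:\Sigma_I^+\to\Sigma_O$; a player wins the game if she/he has a strategy winning all consistent plays. *)

(* Defs.v *)
From mathcomp Require Import all_boot.
Set Implicit Arguments. Unset Strict Implicit. Unset Printing Implicit Defensive.

Inductive formula (V : Type) : Type :=
| FTrue | FFalse
| FVar of V
| FNot of formula V
| FAnd of formula V & formula V
| FOr of formula V & formula V.
Arguments FTrue {V}. Arguments FFalse {V}.

Fixpoint fsize V (phi : formula V) : nat :=
  match phi with
  | FTrue | FFalse | FVar _ => 1
  | FNot p => (fsize p).+1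
  | FAnd p q | FOr p q => (fsize p + fsize q).+1
  end.

Fixpoint fsat V (F : V -> Prop) (phi : formula V) : Prop :=
  match phi with
  | FTrue => True
  | FFalse => False
  | FVar q => F q
  | FNot p => ~ fsat F p
  | FAnd p q => fsat F p /\ fsat F q
  | FOr p q => fsat F p \/ fsat F q
  end.

Record wm_automaton (Sigma : finType) := WMAut {
  st : finType;
  init : st;
  delta : st -> Sigma -> st -> bool;
  acc : formula st }.

Definition aut_size Sigma (A : wm_automaton Sigma) : nat :=
  #|st A| + fsize (acc A).

Definition init_run Sigma (A : wm_automaton Sigma) (w : nat -> Sigma)
  (rho : nat -> st A) : Prop :=
  rho 0 = init A /\ forall i, delta (rho i) (w i) (rho i.+1).

Definition wm_accepting Sigma (A : wm_automaton Sigma) (rho : nat -> st A) : Prop :=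
  fsat (fun q => exists i, rho i = q) (acc A).

Arguments init_run {Sigma} A w rho.
Arguments wm_accepting {Sigma} A rho.

Definition lang Sigma (A : wm_automaton Sigma) (w : nat -> Sigma) : Prop :=
  exists rho, init_run A w rho /\ wm_accepting A rho.

Definition delay_fun (f : nat -> nat) : Prop := forall i, 1 <= f i.
Definition constant_delay (f : nat -> nat) : Prop := forall i, 0 < i -> f i = 1.

Section Games.
Variables (SI SO : finType).

Definition is_concat (f : nat -> nat) (u : nat -> seq SI) (alpha : nat -> SI) : Prop :=
  forall i, u i = mkseq (fun m => alpha (\sum_(j < i) f j + m)) (f i).

Definition legal_play (f : nat -> nat) (u : nat -> seq SI) : Prop :=
  forall i, size (u i) = f i.

Definition strategyI (f : nat -> nat) (tI : seq SO -> seq SI) : Prop :=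
  forall w, size (tI w) = f (size w).

Definition consistentI (tI : seq SO -> seq SI) (u : nat -> seq SI) (v : nat -> SO) :=
  forall i, u i = tI (mkseq v i).

Definition consistentO (tO : seq SI -> SO) (u : nat -> seq SI) (v : nat -> SO) :=
  forall i, v i = tO (flatten (mkseq u i.+1)).

Definition O_wins (f : nat -> nat) (L : (nat -> SI * SO) -> Prop) : Prop :=
  exists tO : seq SI -> SO,
    forall (u : nat -> seq SI) (v : nat -> SO),
      legal_play f u -> consistentO tO u v ->
      forall alpha, is_concat f u alpha -> L (fun k => (alpha k, v k)).

Definition I_wins (f : nat -> nat) (L : (nat -> SI * SO) -> Prop) : Prop :=
  exists tI : seq SO -> seq SI, strategyI f tI /\
    forall (u : nat -> seq SI) (v : nat -> SO),
      legal_play f u -> consistentI tI u v ->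
      forall alpha, is_concat f u alpha -> ~ L (fun k => (alpha k, v k)).
End Games.

(* Main.v *)
From HB Require Import structures.
From Stdlib Require Import Classical IndefiniteDescription.
Require Import Defs.
From mathcomp Require Import all_boot zify.
Set Implicit Arguments. Unset Strict Implicit. Unset Printing Implicit Defensive.

(** Put [P = 2 ^ n.+1] and [N = 2 ^ 2 ^ n].  Player I labels every position with a
    clock value in [0, P), so that the play is cut into periods; in every period
    the first [2 ^ n] bits of each player spell a number below [N], and O is
    supposed to spell the same number [j] in all periods.  O wins if I spells a bad
    pair for [j]: two occurrences of [j] without a larger number in between.  Any
    word of [2 ^ N] numbers below [N] contains a bad pair, so O can choose [j] with
    enough lookahead; the ruler sequence has length [2 ^ N - 1] and no bad pair, so
    with less lookahead I learns [j] first and never spells it again.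

    Being existential, the automaton checks the wrongdoings of I only: a wrong clock
    value is witnessed by one wrong bit of it, and to punish O for changing [j], I
    names an address at which [j] changed.  O refutes this by a run that compares
    O's bits at that address in all periods.  The address does not fit into a state,
    so such a run spells it bit by bit in each period and again while
    reading the challenge, and the acceptance condition asks that the set of visited
    states never contains both values of the same address bit. *)

(** * Binary expansions *)

Definition bit (k i : nat) : bool := odd (k %/ 2 ^ i).

Fixpoint num (x : nat -> bool) (k : nat) : nat :=
  if k is k'.+1 then x 0 + (num (fun i => x i.+1) k').*2 else 0.

Lemma bit0E k : bit k 0 = odd k.
Proof. by rewrite /bit expn0 divn1. Qed.

Lemma bitS k i : bit k i.+1 = bit k./2 i.
Proof. by rewrite /bit expnS divnMA divn2. Qed.

Lemma num_lt x k : num x k < 2 ^ k.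
Proof.
elim: k x => [|k IH] x //=; move: (IH (fun i => x i.+1)); rewrite expnS.
by case: (x 0); lia.
Qed.

Lemma bit_num x k i : i < k -> bit (num x k) i = x i.
Proof.
elim: k x i => [|k IH] x [|i] //= ik.
  by rewrite bit0E oddD odd_double addbF; case: (x 0).
by rewrite bitS half_bit_double IH.
Qed.

Lemma bit_inj m k k' : k < 2 ^ m -> k' < 2 ^ m ->
  (forall i, i < m -> bit k i = bit k' i) -> k = k'.
Proof.
elim: m k k' => [|m IH] k k'; first by rewrite expn0 !ltnS !leqn0 => /eqP-> /eqP->.
rewrite expnS => kl kl' e.
have h : k./2 = k'./2.
  by apply: IH => [||i im]; [lia|lia|rewrite -!bitS e].
by rewrite -(odd_double_half k) -(odd_double_half k') h -!bit0E e.
Qed.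

Lemma modn_bitS k c : k %% 2 ^ c.+1 = bit k c * 2 ^ c + k %% 2 ^ c.
Proof.
rewrite expnS /bit {1}(divn_eq k (2 ^ c)) {1}(divn_eq (k %/ 2 ^ c) 2) modn2.
rewrite mulnDl -mulnA -addnA modnMDl modn_small //.
have : k %% 2 ^ c < 2 ^ c by rewrite ltn_pmod // expn_gt0.
by case: odd; rewrite ?mul1n ?mul0n; lia.
Qed.

Definition ncmp (x y : nat) : option bool := if x == y then None else Some (y < x).

(** Reading from the least significant bit on, a later differing bit overrides the result so far;
    this justifies the update in [cmp_step]. *)
Lemma ncmp_bitS k j c :
  ncmp (k %% 2 ^ c.+1) (j %% 2 ^ c.+1) =
  if bit k c == bit j c then ncmp (k %% 2 ^ c) (j %% 2 ^ c) else Some (bit k c).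
Proof.
have p0 : 0 < 2 ^ c by rewrite expn_gt0.
rewrite !modn_bitS /ncmp; have := ltn_pmod k p0; have := ltn_pmod j p0.
move: (k %% 2 ^ c) (j %% 2 ^ c) (2 ^ c) => a b p bp ap.
case: (bit k c) (bit j c) => [] [] /=; rewrite ?mul1n ?mul0n ?add0n ?eqn_add2l ?ltn_add2l //;
  case: eqP => ?; try lia; congr Some; lia.
Qed.

(** * Bad pairs *)

Definition bad_pair (l : nat -> nat) (p q : nat) : Prop :=
  [/\ p < q, l p = l q & forall k, p < k < q -> l k <= l p].

(** Induction on [N], halving the window: if the largest value occurs in both halves, these two
    occurrences form a bad pair; otherwise one half avoids it and the induction hypothesis applies
    there. *)
Lemma bad_pair_exists l N s :
  (forall m, s <= m < s + 2 ^ N -> l m < N) ->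
  exists p q, [/\ s <= p, q < s + 2 ^ N & bad_pair l p q].
Proof.
elim: N s => [|N IH] s lN; first by have := lN s; rewrite expn0; lia.
have le p : s <= p < s + 2 ^ N.+1 -> l p <= N by move=> /lN; lia.
rewrite expnS in lN le *.
case: (boolP (has (fun m => l m == N) (iota s (2 ^ N)))) => [/hasP [p]|/hasPn h1].
  rewrite mem_iota => ps /eqP lp.
  case: (boolP (has (fun m => l m == N) (iota (s + 2 ^ N) (2 ^ N)))) => [/hasP [q]|/hasPn h2].
    rewrite mem_iota => qs /eqP lq; exists p, q; split; [lia|lia|split; [lia|lia|]].
    by move=> k kpq; rewrite lp; apply: le; lia.
  have [m ms|p' [q' [sp qs bp]]] := IH (s + 2 ^ N).
    have := le m; have := h2 m; rewrite mem_iota; lia.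
  by exists p', q'; split => //; lia.
have [m ms|p' [q' [sp qs bp]]] := IH s.
  have := le m; have := h1 m; rewrite mem_iota; lia.
by exists p', q'; split => //; lia.
Qed.

Definition ruler (m : nat) : nat := logn 2 m.+1.

Lemma ruler_lt m N : m.+1 < 2 ^ N -> ruler m < N.
Proof.
move=> mN; rewrite -(ltn_exp2l _ _ (ltnSn 1)); apply: leq_ltn_trans mN.
by apply: dvdn_leq => //; apply: pfactor_dvdnn.
Qed.

(** Write [p.+1] and [q.+1] as odd multiples [u * 2 ^ k] and [v * 2 ^ k]. The even number [u.+1]
    lies strictly between [u] and [v], and [u.+1 * 2 ^ k] has valuation above [k]. *)
Lemma ruler_no_bad_pair p q : ~ bad_pair ruler p q.
Proof.
case=> pq e le.
have [u /negP up uE] := pfactor_coprime (isT : prime 2) (ltn0Sn p).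
have [v vq vE] := pfactor_coprime (isT : prime 2) (ltn0Sn q).
rewrite -!/(ruler _) -e in uE vE; set k := ruler p in uE vE le.
have k0 : 0 < 2 ^ k by rewrite expn_gt0.
have [ou ov] : odd u /\ odd v by rewrite -!coprime2n; split=> //; apply/negP => ?.
have uv : u.+2 <= v.
  have : u < v by rewrite -(ltn_pmul2r k0); lia.
  by move=> uv; rewrite ltn_neqAle uv andbT; apply: contraTneq ov => <-; rewrite /= ou.
pose r := (u.+1 * 2 ^ k).-1.
have rE : r.+1 = u.+1 * 2 ^ k by rewrite /r prednK // muln_gt0.
have h : p < r < q.
  have : u.+2 * 2 ^ k <= v * 2 ^ k by rewrite leq_pmul2r.
  move: uE vE rE; rewrite !mulSn; lia.
have := le r h; rewrite {1}/ruler rE leqNgt -pfactor_dvdn ?muln_gt0 //.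
by rewrite expnS dvdn_pmul2r // dvdn2 /= ou.
Qed.

(** * The automaton *)

(* [Cmp open o]: [open] tells whether a bad pair has been opened, [o] is the result
   of the current comparison ([None] for equality).  [Expect i b]: bit [i] of the next
   clock value should be [b].  [Wait r], [Spell i b r], [Rest r]: before, while and
   after spelling the address in a period, where [r] is O's bit at this address and
   [b] is bit [i] of the address.  [Chal i b]: bit [i] of the challenged address is [b]. *)
Inductive state (n : nat) : Type :=
| Init
| Cmp of bool & option bool | Done
| Tick | Expect of 'I_n.+1 & bool | Err
| Wait of bool | Spell of 'I_n & bool & bool | Rest of bool
| Chal of 'I_n & bool | Fin.
Arguments Init {n}. Arguments Cmp {n}. Arguments Done {n}. Arguments Tick {n}.
Arguments Err {n}. Arguments Wait {n}. Arguments Rest {n}. Arguments Fin {n}.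

Definition state_code (n : nat) : Type :=
  ('I_5 + bool * option bool + 'I_n.+1 * bool + (bool + bool)
   + 'I_n * bool * bool + 'I_n * bool)%type.

Definition state_enc n (q : state n) : state_code n :=
  match q with
  | Init => inl (inl (inl (inl (inl (@Ordinal 5 0 isT)))))
  | Done => inl (inl (inl (inl (inl (@Ordinal 5 1 isT)))))
  | Tick => inl (inl (inl (inl (inl (@Ordinal 5 2 isT)))))
  | Err => inl (inl (inl (inl (inl (@Ordinal 5 3 isT)))))
  | Fin => inl (inl (inl (inl (inl (@Ordinal 5 4 isT)))))
  | Cmp p o => inl (inl (inl (inl (inr (p, o)))))
  | Expect i b => inl (inl (inl (inr (i, b))))
  | Wait r => inl (inl (inr (inl r)))
  | Rest r => inl (inl (inr (inr r)))
  | Spell i b r => inl (inr (i, b, r))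
  | Chal i b => inr (i, b)
  end.

Definition state_dec n (x : state_code n) : state n :=
  match x with
  | inl (inl (inl (inl (inl i)))) => nth Init [:: Init; Done; Tick; Err; Fin] i
  | inl (inl (inl (inl (inr (p, o))))) => Cmp p o
  | inl (inl (inl (inr (i, b)))) => Expect i b
  | inl (inl (inr (inl r))) => Wait r
  | inl (inl (inr (inr r))) => Rest r
  | inl (inr (i, b, r)) => Spell i b r
  | inr (i, b) => Chal i b
  end.

Lemma state_encK n : cancel (@state_enc n) (@state_dec n).
Proof. by case. Qed.

HB.instance Definition _ n := Countable.copy (state n) (can_type (@state_encK n)).
HB.instance Definition _ n : isFinite (state n) := CanIsFinite (@state_encK n).

Lemma card_state n : #|{: state n}| <= 8 * n + 17.
Proof.
apply: leq_trans (leq_card _ (can_inj (@state_encK n))) _.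
by rewrite !card_sum !card_prod !card_option !card_ord !card_bool; lia.
Qed.

(** The components are a challenge flag, Player I's bit and the clock value. In a challenge the last
    component transmits the address instead. *)
Definition letterI (n : nat) : finType := (bool * bool * 'I_(2 ^ n.+1))%type.
Definition letter (n : nat) : finType := (letterI n * bool)%type.

Definition challenge n (a : letter n) : bool := a.1.1.1.
Definition bitI n (a : letter n) : bool := a.1.1.2.
Definition clock n (a : letter n) : nat := a.1.2.
Definition bitO n (a : letter n) : bool := a.2.

(* The comparison of the two numbers of a period is updated from the least
   significant bit on; it is evaluated and reset at the end of the period. *)
Definition cmp_step n (a : letter n) (q : state n) : state n :=
  match q with
  | Cmp open o =>
      if clock a < 2 ^ n then Cmp open (if bitI a == bitO a then o else Some (bitI a))
      else if (clock a).+1 < 2 ^ n.+1 then Cmp open o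
      else match o with
           | None => if open then Done else Cmp true None
           | Some true => Cmp false None
           | Some false => Cmp open None
           end
  | _ => Done
  end.

(** An address is guessed by starting to spell it when the clock shows it. Its bit [i'] is read [i']
    letters later, hence the argument [clock a - i']. [Wait] is left before the second half of a
    period, so every period spells an address. *)
Definition step n (q : state n) (a : letter n) (q' : state n) : bool :=
  match q, q' with
  | (Cmp _ _ | Done), (Cmp _ _ | Done) => ~~ challenge a && (q' == cmp_step a q)
  | Tick, Tick => ~~ challenge a
  | Tick, Expect i b => ~~ challenge a && (b == bit ((clock a).+1 %% 2 ^ n.+1) i)
  | Expect i b, Err => ~~ challenge a && (b != bit (clock a) i)
  | Err, Err => true
  | Wait r, Wait r' => [&& ~~ challenge a, clock a < 2 ^ n & r' == r]
  | Wait r, Spell i b r' =>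
      [&& ~~ challenge a, clock a < 2 ^ n, r' == r, i == 0 :> nat,
          b == bit (clock a) 0 & bitO a == r]
  | Rest r, Wait r' => [&& ~~ challenge a, clock a == 0 & r' == r]
  | Rest r, Rest r' => [&& ~~ challenge a, clock a != 0 & r' == r]
  | Rest r, Spell i b r' =>
      [&& ~~ challenge a, clock a == 0, r' == r, i == 0 :> nat,
          b == bit (clock a) 0 & bitO a == r]
  | Spell i b r, Spell i' b' r' =>
      [&& ~~ challenge a, r' == r, i' == i.+1 :> nat & b' == bit (clock a - i') i']
  | Spell i b r, Rest r' => [&& ~~ challenge a, r' == r & i.+1 == n]
  | (Wait _ | Spell _ _ _ | Rest _), Chal i b =>
      [&& challenge a, i == 0 :> nat & b == bit (clock a) 0]
  | Chal i b, Chal i' b' => (i' == i.+1 :> nat) && (b' == bit (clock a) i')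
  | Chal i b, Fin => i.+1 == n
  | Fin, Fin => true
  | _, _ => false
  end.

(** [Expect _ false] covers an error in the first letter: the clock has to start at 0, all of whose
    bits are false. *)
Definition start n (q : state n) : bool :=
  match q with
  | Cmp false None | Tick | Expect _ false | Rest _ => true
  | _ => false
  end.

Definition trans n (q : state n) (a : letter n) (q' : state n) : bool :=
  if q is Init then [exists q0, start q0 && step q0 a q'] else step q a q'.

Definition spelled n (i : 'I_n) (b : bool) : formula (state n) :=
  FOr (FVar (Chal i b)) (FOr (FVar (Spell i b false)) (FVar (Spell i b true))).

Definition no_clash n : formula (state n) :=
  foldr (fun i => FAnd (FNot (FAnd (spelled i false) (spelled i true)))) FTrue (enum 'I_n).

Definition aut n : wm_automaton (letterI n * bool)%type :=
  @WMAut (letterI n * bool)%type (state n) Init (@trans n)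
    (FOr (FVar Done) (FOr (FVar Err) (FAnd (FVar Fin) (no_clash n)))).

Lemma aut_size_le n : aut_size (aut n) <= 21 * n + 24.
Proof.
have szE : fsize (no_clash n) = 13 * n + 1.
  rewrite /no_clash -[in RHS](size_enum_ord n).
  by elim: (enum _) => [|i s IH] //=; rewrite IH mulnS; move: (13 * _) => k; lia.
have -> : 21 * n + 24 = 8 * n + 17 + (13 * n + 7) by lia.
by apply: leq_add (card_state n) _; rewrite /= szE; lia.
Qed.

(** * Acceptance in terms of runs from a start state *)

Definition path_from_start n (w : nat -> letter n) (rho : nat -> state n) : Prop :=
  start (rho 0) /\ forall t, step (rho t) (w t) (rho t.+1).

Definition visits n (rho : nat -> state n) (q : state n) : Prop := exists t, rho t = q.

Definition spells n (rho : nat -> state n) (i : 'I_n) (b : bool) : Prop :=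
  visits rho (Chal i b) \/ exists r, visits rho (Spell i b r).

Definition accepted n (rho : nat -> state n) : Prop :=
  visits rho Done \/ visits rho Err \/
  (visits rho Fin /\ forall i, ~ (spells rho i false /\ spells rho i true)).

Lemma fsat_spelled n (rho : nat -> state n) i b :
  fsat (visits rho) (spelled i b) <-> spells rho i b.
Proof.
rewrite /spells /=; split; first by case=> [|[]]; by [left|right; exists false|right; exists true].
by case=> [|[[]]]; by [left|right; left|right; right].
Qed.

Lemma fsat_no_clash n (rho : nat -> state n) :
  fsat (visits rho) (no_clash n) <->
  forall i, ~ (spells rho i false /\ spells rho i true).
Proof.
have H s : fsat (visits rho) (foldr
    (fun i => FAnd (FNot (FAnd (spelled i false) (spelled i true)))) FTrue s) <->
    forall i, i \in s -> ~ (spells rho i false /\ spells rho i true).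
  elim: s => [|i s IH]; first by split.
  split=> [[h1 h2] k|h].
    rewrite inE => /orP [/eqP->|ks]; last exact: (proj1 IH).
    by case=> a b; apply: h1; split; apply/fsat_spelled.
  split; last by apply/IH => k ks; apply: h; rewrite inE ks orbT.
  by case=> /fsat_spelled a /fsat_spelled b; apply: (h i); rewrite ?mem_head.
rewrite H; split=> h i; first by apply: h; rewrite mem_enum.
by move=> _; apply: h.
Qed.

Lemma wm_acceptingP n (rho : nat -> state n) :
  wm_accepting (aut n) rho <-> accepted rho.
Proof. by rewrite /wm_accepting /accepted -fsat_no_clash. Qed.

(** Acceptance depends only on visits to [Done], [Err], [Fin], [Chal] and [Spell], none of which is
    [Init] or a start state, so the first state may be exchanged. *)
Lemma accepted_eqS n (rho rho' : nat -> state n) :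
  (forall t, rho t.+1 = rho' t.+1) ->
  start (rho 0) || (rho 0 == Init) -> start (rho' 0) || (rho' 0 == Init) ->
  accepted rho -> accepted rho'.
Proof.
have half r r' q : (forall t, r t.+1 = r' t.+1) -> start (r 0) || (r 0 == Init) ->
    ~~ (start q || (q == Init)) -> visits r q -> visits r' q.
  by move=> e s0 nq [[|t] h]; [rewrite -h s0 in nq | exists t.+1; rewrite -e].
move=> e s0 s0' [h|[h|[h1 h2]]].
- by left; apply: half h.
- by right; left; apply: half h.
right; right; split; first by apply: half h1.
have S i b : spells rho' i b -> spells rho i b.
  have e' t : rho' t.+1 = rho t.+1 by rewrite e.
  by case=> [h|[r h]]; [left|right; exists r]; apply: half h.
by move=> i [/S a /S b]; apply: (h2 i).
Qed.

Lemma lang_autP n (w : nat -> letter n) :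
  lang (aut n) w <-> exists rho, path_from_start w rho /\ accepted rho.
Proof.
split=> [[rho [[r0 rS] /wm_acceptingP ac]]|[rho [[s0 rS] ac]]].
  have := rS 0; rewrite r0 /= => /existsP [q0 /andP [s0 d0]].
  have nI t : rho t.+1 <> Init.
    elim: t => [|t IH] e; first by move: d0; rewrite e; case: (q0).
    by have := rS t.+1; rewrite e /=; case: (rho t.+1) IH.
  exists (fun t => if t is _.+1 then rho t else q0); split.
    split=> // -[|t] //=; have := rS t.+1; have := nI t; rewrite /= /trans.
    by case: (rho t.+1).
  by apply: accepted_eqS ac => //=; rewrite ?s0 ?r0 ?eqxx ?orbT.
exists (fun t => if t is _.+1 then rho t else Init); split.
  split=> // -[|t] /=; first by apply/existsP; exists (rho 0); rewrite s0 /= rS.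
  have := rS t.+1; rewrite /trans; case: (rho t.+1) (rS t) => //=.
by apply/wm_acceptingP; apply: accepted_eqS ac => //=; rewrite ?s0 ?eqxx ?orbT.
Qed.

(** * Detecting bad pairs *)

(** The comparing run, one period at a time: [None] once a bad pair for [j] is complete, otherwise
    [Some open], where [open] tells whether [j] has occurred with no larger number since. *)
Fixpoint pair_scan (l : nat -> nat) (j m : nat) : option bool :=
  if m is m'.+1 then
    if pair_scan l j m' is Some open then
      match ncmp (l m') j with
      | None => if open then None else Some true
      | Some true => Some false
      | Some false => Some open
      end
    else None
  else Some false.

Lemma pair_scanS l j m : pair_scan l j m.+1 =
  if pair_scan l j m is Some open then
    match ncmp (l m) j with
    | None => if open then None else Some true
    | Some true => Some false
    | Some false => Some open
    end
  else None.
Proof. by []. Qed.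

Lemma pair_scan_complete l p q : bad_pair l p q -> pair_scan l (l p) q.+1 = None.
Proof.
(* After [p] no number before [q] exceeds [l p], so the scan stays open or has succeeded already. *)
case=> pq e le.
have inside d : p + d < q -> pair_scan l (l p) (p + d).+1 \in [:: None; Some true].
  elim: d => [|d IH] pd.
    by rewrite addn0 /= /ncmp eqxx; case: pair_scan => [[]|].
  rewrite addnS in pd *; rewrite pair_scanS /ncmp; have := IH (ltnW pd).
  case: pair_scan => [[|]|] // _; case: (l _ =P l p) => // _.
  by rewrite ltnNge le //=; lia.
have := inside (q.-1 - p); have -> : (p + (q.-1 - p)).+1 = q by lia.
rewrite /= /ncmp -e eqxx => /(_ ltac:(lia)).
by case: pair_scan => [[]|].
Qed.

Lemma pair_scan_sound l j m :
  pair_scan l j m = None -> exists p q, [/\ q < m, bad_pair l p q & l p = j].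
Proof.
have open_sound k : pair_scan l j k = Some true ->
    exists p, [/\ p < k, l p = j & forall i, p < i < k -> l i <= j].
  elim: k => //= k IH; rewrite /ncmp; case: pair_scan IH => // b IH.
  case: eqP => [lk|nlk].
    by case: b IH => // _ _; exists k; split=> // i; lia.
  case: (ltnP j (l k)) => // jl bt; have [p [pk lp le]] := IH bt.
  exists p; split=> //; first exact: ltnW.
  move=> i /andP [pi]; rewrite ltnS leq_eqVlt => /orP [/eqP->//|ik].
  by apply: le; rewrite pi.
elim: m => //= m IH.
case E: pair_scan IH => [b|] IH; last first.
  by have [p [q [qm bp lp]]] := IH erefl; exists p, q; split=> //; apply: ltnW.
rewrite /ncmp; case: eqP => [lm|_]; last by case: ltnP.
case: b E IH => // /open_sound [p [pm lp le]] _ _.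
by exists p, m; split=> //; split; rewrite ?lp // => k; apply: le.
Qed.

Fixpoint cmp_run n (w : nat -> letter n) (t : nat) : state n :=
  if t is t'.+1 then cmp_step (w t') (cmp_run w t') else Cmp false None.

Lemma cmp_run_Done n (w : nat -> letter n) t d :
  cmp_run w t = Done -> cmp_run w (t + d) = Done.
Proof. by move=> e; elim: d => [|d IHd]; rewrite ?addn0 // addnS /= IHd. Qed.

Lemma exp2S n : 2 ^ n.+1 = 2 ^ n + 2 ^ n.
Proof. by rewrite expnS mul2n addnn. Qed.

Lemma period_mod n m c : c < 2 ^ n.+1 -> (m * 2 ^ n.+1 + c) %% 2 ^ n.+1 = c.
Proof. by move=> cP; rewrite modnMDl modn_small. Qed.

(** In the first half of a period the run compares ever longer low parts of the two numbers ([low]),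
    in the second half it carries the result ([high]), and the last letter performs one step of
    [pair_scan]. *)
Lemma cmp_run_scan n (w : nat -> letter n) l j :
  (forall t, clock (w t) = t %% 2 ^ n.+1) ->
  (forall m c, c < 2 ^ n -> bitI (w (m * 2 ^ n.+1 + c)) = bit (l m) c) ->
  (forall m c, c < 2 ^ n -> bitO (w (m * 2 ^ n.+1 + c)) = bit j c) ->
  (forall m, l m < 2 ^ 2 ^ n) -> j < 2 ^ 2 ^ n ->
  forall m, cmp_run w (m * 2 ^ n.+1) =
    if pair_scan l j m is Some open then Cmp open None else Done.
Proof.
move=> ck bI bO lN jN; elim=> [|m IH]; first by rewrite mul0n.
have P2 := exp2S n; have n2 := ltn_expl n (ltnSn 1).
rewrite mulSnr /=; case: pair_scan IH => [open|] IH; last exact: cmp_run_Done.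
have low c : c <= 2 ^ n ->
    cmp_run w (m * 2 ^ n.+1 + c) = Cmp open (ncmp (l m %% 2 ^ c) (j %% 2 ^ c)).
  elim: c => [|c IHc] cn; first by rewrite addn0 IH expn0 !modn1.
  rewrite addnS /= IHc ?(ltnW cn) //= ck period_mod; last by lia.
  by rewrite cn bI // bO // ncmp_bitS.
have high d : 2 ^ n + d < 2 ^ n.+1 ->
    cmp_run w (m * 2 ^ n.+1 + (2 ^ n + d)) = Cmp open (ncmp (l m) j).
  elim: d => [|d IHd] dn; first by rewrite addn0 low // !modn_small.
  rewrite !addnS /= IHd; last by lia.
  rewrite /= ck period_mod; last by lia.
  by rewrite ifN ?ifT //; lia.
have -> : m * 2 ^ n.+1 + 2 ^ n.+1 = (m * 2 ^ n.+1 + (2 ^ n + (2 ^ n).-1)).+1 by lia.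
rewrite /= high; last by lia.
rewrite /= ck period_mod; last by lia.
rewrite ifF; last by lia.
rewrite ifF; last by lia.
by case: ncmp => [[]|]; case: (open).
Qed.

Definition comparing n (q : state n) : bool :=
  if q is (Cmp _ _ | Done) then true else false.

Lemma comparing_cmp_step n (a : letter n) q : comparing (cmp_step a q).
Proof.
by case: q => //= b o; do 2!case: ifP => // _; case: o => [[]|]; case: b.
Qed.

Lemma comparing_step n (a : letter n) q q' : comparing q ->
  step q a q' = ~~ challenge a && (q' == cmp_step a q).
Proof.
have := comparing_cmp_step a q; case: q => // [b o|] Cq _.
  by case: q' => // *; rewrite /step; case: eqP Cq => [<-|] //; rewrite andbF.
by case: q' => // *; rewrite /= ?andbF.
Qed.

Lemma step_comparing n (a : letter n) q q' : step q a q' -> comparing q' = comparing q.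
Proof.
by case: q => [|? ?|||? ?||?|? ? ?|?|? ?|]; case: q' => [|? ?|||? ?||?|? ? ?|?|? ?|].
Qed.

Lemma accepted_cmp_run n (w : nat -> letter n) t :
  (forall t, ~~ challenge (w t)) -> cmp_run w t = Done ->
  exists rho, path_from_start w rho /\ accepted rho.
Proof.
move=> nc e; exists (cmp_run w); split; last by left; exists t.
split=> // -[|s]; rewrite comparing_step ?nc //=; exact: comparing_cmp_step.
Qed.

(** The comparing states are closed under steps in both directions and deterministic, so a run
    through [Done] coincides with [cmp_run]. *)
Lemma run_Done n (w : nat -> letter n) rho :
  path_from_start w rho -> visits rho Done ->
  (forall t, ~~ challenge (w t)) /\ exists t, cmp_run w t = Done.
Proof.
case=> s0 rS [s e].
have C t : comparing (rho t) = comparing (rho 0).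
  by elim: t => // t IH; rewrite (step_comparing (rS t)).
have Cs t : comparing (rho t) by rewrite C -(C s) e.
have {}rS t : ~~ challenge (w t) && (rho t.+1 == cmp_step (w t) (rho t)).
  by rewrite -comparing_step.
split=> [t|]; first by case/andP: (rS t).
exists s; rewrite -e; elim: (s) => [|t IH] /=.
  by move: s0 (Cs 0); case: (rho 0) => // -[] // [].
by have /andP [_ /eqP ->] := rS t; rewrite IH.
Qed.

(** * Detecting clock errors *)

Definition on_time n (w : nat -> letter n) (t : nat) : bool :=
  ~~ challenge (w t) && (clock (w t) == t %% 2 ^ n.+1).

Lemma clock_lt n (a : letter n) : clock a < 2 ^ n.+1.
Proof. exact: ltn_ord. Qed.

Lemma modnS_mod t d : (t %% d).+1 %% d = t.+1 %% d.
Proof. by rewrite -addn1 modnDml addn1. Qed.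

(** The run stays in [Tick] and, one letter before the error, guesses a bit in which the wrong value
    will differ; if [t0] is 0 it starts in [Expect]. *)
Lemma accepted_clock_error n (w : nat -> letter n) t0 :
  (forall t, t < t0 -> on_time w t) -> ~~ challenge (w t0) ->
  clock (w t0) <> t0 %% 2 ^ n.+1 ->
  exists rho, path_from_start w rho /\ accepted rho.
Proof.
move=> ok nc0 err.
have P0 : 0 < 2 ^ n.+1 by rewrite expn_gt0.
have [i di] : exists i : 'I_n.+1, bit (t0 %% 2 ^ n.+1) i != bit (clock (w t0)) i.
  apply/existsP; apply: contraT; rewrite negb_exists => /forallP e.
  case: err; apply: (@bit_inj n.+1); rewrite ?ltn_pmod ?clock_lt //.
  by move=> i ltin; have := e (Ordinal ltin); rewrite negbK => /eqP.
exists (fun t => if t < t0 then Tick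
                 else if t == t0 then Expect i (bit (t0 %% 2 ^ n.+1) i) else Err).
split; last by right; left; exists t0.+1; rewrite ltnNge leqnSn /= ifN //; lia.
split=> [|t].
  by case: ltnP => // t00; rewrite eq_sym -leqn0 t00 (_ : t0 = 0) ?mod0n /bit ?div0n //=; lia.
case: (ltngtP t t0) => [tt0|tt0|->].
- have /andP [nc /eqP ck] := ok t tt0.
  case: (ltngtP t.+1 t0) => [|h|h] //=; first by lia.
  by rewrite nc ck modnS_mod h /=.
- by rewrite ltnNge (ltnW (leqW tt0)) /= ifN //; lia.
- by rewrite ltnNge leqnSn /= ifN ?nc0 ?di //; lia.
Qed.

(** While a run is in [Tick] or [Expect] no challenge has been read, so the expected bit comes from
    a correct clock and is never refuted. *)
Lemma run_Err n (w : nat -> letter n) rho :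
  (forall t, (forall s, s <= t -> ~~ challenge (w s)) -> clock (w t) = t %% 2 ^ n.+1) ->
  path_from_start w rho -> ~ visits rho Err.
Proof.
move=> ck [s0 rS] [s e].
have inv t : match rho t with
             | Tick => forall u, u < t -> ~~ challenge (w u)
             | Expect i b => (forall u, u < t -> ~~ challenge (w u)) /\ b = bit (t %% 2 ^ n.+1) i
             | Err => False
             | _ => True
             end.
  elim: t => [|t IH].
    case: (rho 0) s0 => // i [] // _; split=> //.
    by rewrite mod0n /bit div0n.
  have nxt : (forall u, u < t -> ~~ challenge (w u)) -> ~~ challenge (w t) ->
      forall u, u < t.+1 -> ~~ challenge (w u).
    by move=> h1 h2 u; rewrite ltnS leq_eqVlt => /orP [/eqP->|/h1].
  have := rS t; case: (rho t) IH => [|? ?|||i b||?|? ? ?|?|? ?|] IH;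
    case: (rho t.+1) => [|? ?|||i' b'||?|? ? ?|?|? ?|] //=.
  - exact: nxt.
  - move=> /andP [nc /eqP ->]; split; first exact: nxt.
    by rewrite ck ?modnS_mod //; exact: nxt.
  - case: IH => h -> /andP [nc]; rewrite ck ?eqxx //; exact: nxt.
by have := inv s; rewrite e.
Qed.

(** * Challenges *)

(** The state right after a letter with clock value [c], in a run auditing address [a]. Spelling
    starts at clock value [a] and, for [a < 2 ^ n], ends within the period. *)
Definition track n (a : nat) (r : bool) (c : nat) : state n :=
  if c < a then Wait r
  else if insub (c - a) is Some i then Spell i (bit a i) r else Rest r.

Lemma insub_ordT n i (h : i < n) : insub i = Some (Ordinal h).
Proof. by rewrite insubT. Qed.

Lemma insub_ordF n i : n <= i -> insub i = None :> option 'I_n.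
Proof. by move=> h; rewrite insubF // ltnNge h. Qed.

(** The first [track] is taken at the cyclic predecessor of [c], so that one formula also covers the
    passage to a new period. *)
Lemma step_track n (w : letter n) a r c :
  0 < n -> a < 2 ^ n -> c < 2 ^ n.+1 -> ~~ challenge w -> clock w = c ->
  (c = a -> bitO w = r) ->
  step (track n a r ((c + (2 ^ n.+1).-1) %% 2 ^ n.+1)) w (track n a r c).
Proof.
move=> n0 an cP nc ck bO; have P2 := exp2S n; have n2 := ltn_expl n (ltnSn 1).
have [c0|c0] := posnP c.
  rewrite c0 add0n modn_small ?prednK //; try lia.
  rewrite {1}/track ifF; last by lia.
  rewrite insub_ordF; last by lia.
  rewrite /track; case: ltnP => a0; first by rewrite /= nc ck c0 !eqxx.
  have aE : a = 0 by lia.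
  by rewrite aE subnn insub_ordT /= nc ck c0 !eqxx /= bO ?eqxx // c0 aE.
have -> : (c + (2 ^ n.+1).-1) %% 2 ^ n.+1 = c.-1.
  rewrite (_ : c + _ = 2 ^ n.+1 + c.-1); last by lia.
  by rewrite modnDl modn_small //; lia.
rewrite /track; case: (ltnP c.-1 a) => h1; case: (ltnP c a) => h2; try lia.
- by rewrite /= nc ck eqxx andbT; lia.
- have cE : c = a by lia.
  by rewrite cE subnn insub_ordT /= nc ck cE !eqxx /= bO // eqxx; lia.
- case: (ltnP (c.-1 - a) n) => h3; last first.
    rewrite insub_ordF // insub_ordF; last by lia.
    by rewrite /= nc ck eqxx andbT; lia.
  rewrite insub_ordT; case: (ltnP (c - a) n) => h4.
    rewrite insub_ordT /= nc ck !eqxx /=.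
    by rewrite (_ : c - (c - a) = a) ?eqxx ?andbT //; lia.
  by rewrite insub_ordF //= nc eqxx /=; lia.
Qed.

Lemma track_spells n a r c i b r' : track n a r c = Spell i b r' -> b = bit a i.
Proof. by rewrite /track; case: ltnP => // _; case: insub => // k [-> <- _]. Qed.

Lemma accepted_challenge n (w : nat -> letter n) t0 j :
  0 < n -> (forall t, t < t0 -> on_time w t) -> challenge (w t0) ->
  (forall t, t %% 2 ^ n.+1 < 2 ^ n -> bitO (w t) = bit j (t %% 2 ^ n.+1)) ->
  exists rho, path_from_start w rho /\ accepted rho.
Proof.
move=> n0 ok ch bO; have P2 := exp2S n; have n2 := ltn_expl n (ltnSn 1).
have P0 : 0 < 2 ^ n.+1 by rewrite expn_gt0.
(* The run guesses the address from the future. Bit [k] comes from the [k]-th letter of the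
   challenge, as Player I may change the last component meanwhile. *)
pose a := num (fun k => bit (clock (w (t0 + k))) k) n.
have an : a < 2 ^ n by apply: num_lt.
pose r := bit j a.
pose T t : state n := track n a r ((t + (2 ^ n.+1).-1) %% 2 ^ n.+1).
pose rho t : state n := if t <= t0 then T t else
  if insub (t - t0.+1) is Some i then Chal i (bit (clock (w (t0 + i))) i) else Fin.
exists rho; split.
  split.
    rewrite /rho leq0n /T add0n modn_small ?prednK //.
    rewrite /track ifF ?insub_ordF //; lia.
  move=> t; rewrite /rho; case: (ltngtP t t0) => [tt0|tt0|->].
  - have /andP [nc /eqP ck] := ok t tt0.
    have -> : T t.+1 = track n a r (t %% 2 ^ n.+1).
      by rewrite /T addSnnS prednK // modnDr.
    rewrite /T -(modnDml t); apply: step_track => //; first exact: ltn_pmod.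
    by move=> e; rewrite bO e.
  - case: (ltnP (t - t0.+1) n) => h; last first.
      by rewrite insub_ordF // insub_ordF //; lia.
    rewrite insub_ordT; case: (ltnP (t.+1 - t0.+1) n) => h'.
      rewrite insub_ordT /=; have -> : t0 + (t.+1 - t0.+1) = t by lia.
      by rewrite eqxx andbT; lia.
    by rewrite insub_ordF //=; lia.
  - rewrite subnn insub_ordT /= addn0.
    rewrite /T /track; case: ifP => _; first by rewrite /= ch eqxx.
    by case: insub => [i|]; rewrite /= ch eqxx.
right; right; split.
  exists (t0 + n).+1; rewrite /rho ifF; last by lia.
  by rewrite insub_ordF //; lia.
have sp i b : spells rho i b -> b = bit a i.
  case=> [|[r']] [t]; rewrite /rho; case: leqP => _; try by [].
  - by rewrite /T /track; case: ifP => // _; case: insub.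
  - by case: insub => // k [-> <-]; rewrite /a bit_num.
  - exact: track_spells.
  - by case: insub.
by move=> i [/sp e1 /sp e2]; rewrite -e2 in e1.
Qed.

Definition tracking n (r : bool) (q : state n) : bool :=
  match q with Wait r' | Spell _ _ r' | Rest r' => r' == r | _ => false end.

Definition auditing n (q : state n) : bool :=
  match q with Wait _ | Spell _ _ _ | Rest _ | Chal _ _ | Fin => true | _ => false end.

Lemma step_auditing n (a : letter n) q q' : step q a q' -> auditing q' = auditing q.
Proof.
by case: q => [|? ?|||? ?||?|? ? ?|?|? ?|]; case: q' => [|? ?|||? ?||?|? ? ?|?|? ?|].
Qed.

Lemma step_tracking n (a : letter n) r q q' :
  ~~ challenge a -> tracking r q -> step q a q' -> tracking r q'.
Proof.
move=> nc; case: q => [|? ?|||? ?||?|? ? ?|?|? ?|] //= /eqP ->;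
  case: q' => [|? ?|||? ?||?|? ? ?|?|? ?|] //=; rewrite ?(negPf nc) //.
all: by case/and3P => // _ h1 h2; rewrite ?(eqP h1) ?(eqP h2) ?eqxx //;
  move: h1 h2 => /eqP // h1 /andP [/eqP ->].
Qed.

(** Waiting is impossible in the second half of a period, and without a challenge a started spelling
    runs to its end. Hence the period spells one complete address, at which O's bit is [r]. *)
Lemma run_period_spell n (w : nat -> letter n) rho r m :
  0 < n -> (forall t, step (rho t) (w t) (rho t.+1)) ->
  (forall c, c < 2 ^ n.+1 -> on_time w (m * 2 ^ n.+1 + c)) ->
  rho (m * 2 ^ n.+1) = Rest r ->
  rho (m.+1 * 2 ^ n.+1) = Rest r /\
  exists c, [/\ c < 2 ^ n, bitO (w (m * 2 ^ n.+1 + c)) = r &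
    forall k : 'I_n, rho (m * 2 ^ n.+1 + c + k).+1 = Spell k (bit c k) r].
Proof.
move=> n0 rS ok r0; have P2 := exp2S n; have n2 := ltn_expl n (ltnSn 1).
pose B := m * 2 ^ n.+1.
(* After the letter at offset [s] the run is either still waiting or has begun to spell at some
   offset [c <= s]. *)
suff inv s : s < 2 ^ n.+1 ->
    (rho (B + s).+1 = Wait r /\ s < 2 ^ n) \/
    exists c, [/\ c <= s, c < 2 ^ n, bitO (w (B + c)) = r,
      forall k : 'I_n, c + k <= s -> rho (B + c + k).+1 = Spell k (bit c k) r &
      c + n <= s -> rho (B + s).+1 = Rest r].
  have [//|[_]|[c [_ cn bO sp re]]] := inv (2 ^ n.+1).-1; try lia.
  split.
    have -> : m.+1 * 2 ^ n.+1 = (B + (2 ^ n.+1).-1).+1 by rewrite mulSnr /B; lia.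
    by apply: re; lia.
  exists c; split=> // k; apply: sp; have := ltn_ord k; lia.
have enter c (i : 'I_n) b r' : c < 2 ^ n ->
    rho (B + c).+1 = Spell i b r' ->
    [&& r' == r, i == 0 :> nat, b == bit c 0 & bitO (w (B + c)) == r] ->
    exists c', [/\ c' <= c, c' < 2 ^ n, bitO (w (B + c')) = r,
      forall k : 'I_n, c' + k <= c -> rho (B + c' + k).+1 = Spell k (bit c' k) r &
      c' + n <= c -> rho (B + c).+1 = Rest r].
  move=> cn e /and4P [/eqP rE /eqP i0 /eqP bE /eqP bO].
  exists c; split=> // [k kc|]; last by lia.
  have k0 : k = 0 :> nat by lia.
  by rewrite k0 addn0 e bE rE; congr Spell; apply: val_inj; rewrite /= i0 k0.
elim: s => [|s IH] sP.
  have /andP [nc /eqP] := ok 0 sP; rewrite period_mod // => ck.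
  have := rS (B + 0); rewrite -/B in nc ck.
  rewrite {1}addn0 r0 /=; case E: (rho _) => [|? ?|||? ?||r'|i b r'|r'|? ?|] //=;
    rewrite ck ?(negPf nc) //.
    by case/and3P => _ _ /eqP ->; left; split=> //; lia.
  by case/and3P => _ _ h; right; rewrite -E; apply: (enter 0 i b r') => //; lia.
have /andP [nc /eqP] := ok s.+1 sP; rewrite period_mod // => ck.
have := rS (B + s.+1); rewrite -/B in nc ck.
case: IH => [|[e sn]|[c [cs cn bO sp re]]]; first by lia.
  rewrite {1}addnS e /=; case E: (rho _) => [|? ?|||? ?||r'|i b r'|r'|? ?|] //=;
    rewrite ck ?(negPf nc) //.
    by case/and3P => _ h /eqP ->; left.
  by case/and3P => _ h h'; right; rewrite -E; apply: (enter s.+1 i b r').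
move=> st; right; exists c; split=> //; first exact: ltnW.
  move=> k; rewrite leq_eqVlt => /orP [/eqP ks|]; last by rewrite ltnS => /sp.
  case: k ks => [[|k] kn] /= ks; first by lia.
  have e := sp (Ordinal (ltnW kn)) ltac:(rewrite /=; lia).
  have sE : B + s.+1 = (B + c + k).+1 by lia.
  have -> : B + c + k.+1 = B + s.+1 by lia.
  move: st; rewrite {1}sE e /=.
  case E: (rho _) => [|? ?|||? ?||?|i b r'|?|? ?|] //=; rewrite ?(negPf nc) //.
    case/and4P => _ /eqP -> /eqP i0 /eqP ->; rewrite ck i0 (_ : s.+1 - k.+1 = c); last by lia.
    by congr Spell; apply: val_inj.
  by case/and3P => _ _ /eqP h; exfalso; lia.
move=> cns.
have [cn'|cn'] := leqP (c + n) s.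
  move: st; rewrite {1}addnS re //=.
  case E: (rho _) => [|? ?|||? ?||?|? ? ?|?|? ?|] //=; rewrite ck ?(negPf nc) //.
  by case/andP => _ /eqP ->.
have h : n.-1 < n by lia.
have e := sp (Ordinal h) ltac:(rewrite /=; lia).
have sE : B + s.+1 = (B + c + n.-1).+1 by lia.
move: st; rewrite {1}sE e /=.
case E: (rho _) => [|? ?|||? ?||?|i b r'|?|? ?|] //=; rewrite ?(negPf nc) //.
  by case/and4P => _ _ /eqP i0; have := ltn_ord i; lia.
by case/and3P => _ /eqP ->.
Qed.

Lemma run_Fin_start n (w : nat -> letter n) rho :
  path_from_start w rho -> visits rho Fin -> exists r, rho 0 = Rest r.
Proof.
case=> s0 rS [s e].
have A t : auditing (rho t) = auditing (rho 0).
  by elim: t => // t IH; rewrite (step_auditing (rS t)).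
by move: (A s) s0; rewrite e; case: (rho 0) => //= r _ _; exists r.
Qed.

Lemma run_tracking n (w : nat -> letter n) rho r T :
  (forall t, step (rho t) (w t) (rho t.+1)) -> rho 0 = Rest r ->
  (forall t, t < T -> ~~ challenge (w t)) -> tracking r (rho T).
Proof.
move=> rS r0; elim: T => [|T IH] nc; first by rewrite r0 /=.
by apply: step_tracking (nc T _) (IH _) (rS T) => // t tT; apply/nc/ltnW.
Qed.

(** The challenge makes the run spell all bits of [a], and every complete period before [T] spells
    some address; without a clash this address is [a], so the same [r] was checked there each
    time. *)
Lemma run_Fin n (w : nat -> letter n) rho T a :
  0 < n -> a < 2 ^ n ->
  (forall t, t < T -> on_time w t) ->
  (forall t, T <= t -> challenge (w t) /\ clock (w t) = a) ->
  path_from_start w rho -> visits rho Fin ->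
  (forall i, ~ (spells rho i false /\ spells rho i true)) ->
  exists r, forall m, m.+1 * 2 ^ n.+1 <= T -> bitO (w (m * 2 ^ n.+1 + a)) = r.
Proof.
move=> n0 an ok ch pth vF ncl; have [r r0] := run_Fin_start pth vF.
case: pth => _ rS; exists r.
have trk : tracking r (rho T) by apply: run_tracking => // t /ok /andP [].
have chal k (kn : k < n) : rho (T + k).+1 = Chal (Ordinal kn) (bit a k).
  elim: k kn => [|k IH] kn.
    have [c ck] := ch (T + 0) (leq_addr _ _).
    have := rS (T + 0); rewrite {1}addn0; move: trk.
    case: (rho T) => [|? ?|||? ?||?|? ? ?|?|? ?|] //= _;
    case: (rho _) => [|? ?|||? ?||?|? ? ?|?|i b|] //=;
    rewrite c // ck /= => /andP [/eqP i0 /eqP ->];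
    by congr Chal; apply: val_inj.
  have [c ck] := ch (T + k.+1) (leq_addr _ _).
  have := rS (T + k.+1); rewrite {1}addnS (IH (ltnW kn)) /=.
  case: (rho _) => [|? ?|||? ?||?|? ? ?|?|i b|] //=; last first.
    by move=> /eqP h; exfalso; lia.
  by rewrite ck => /andP [/eqP i0 /eqP ->]; rewrite i0; congr Chal; apply: val_inj.
have per m : m * 2 ^ n.+1 <= T -> rho (m * 2 ^ n.+1) = Rest r.
  elim: m => [|m IH] mT; first by rewrite mul0n.
  have [||//] := @run_period_spell n w rho r m n0 rS.
    by move=> c cP; apply: ok; apply: leq_trans mT; rewrite mulSnr ltn_add2l.
  by apply: IH; apply: leq_trans mT; rewrite mulSnr leq_addr.
move=> m mT.
have [||_ [c [cn bO sp]]] := @run_period_spell n w rho r m n0 rS.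
- by move=> c cP; apply: ok; apply: leq_trans mT; rewrite mulSnr ltn_add2l.
- by apply: per; apply: leq_trans mT; rewrite mulSnr leq_addr.
suff -> : a = c by [].
apply: (@bit_inj n) => // k kn.
have h1 : spells rho (Ordinal kn) (bit a k) by left; exists (T + k).+1; rewrite chal.
have h2 : spells rho (Ordinal kn) (bit c k).
  by right; exists r; exists (m * 2 ^ n.+1 + c + k).+1; rewrite (sp (Ordinal kn)).
by case: (bit a k) h1 (bit c k) h2 => h1 [] h2 //; case: (ncl (Ordinal kn)).
Qed.

(** * Player O wins with large lookahead *)

Lemma mkseqD (T : Type) (f : nat -> T) a b :
  mkseq f (a + b) = mkseq f a ++ mkseq (fun m => f (a + m)) b.
Proof. by rewrite /mkseq iotaD map_cat add0n -[in iota a b](addn0 a) iotaDl -map_comp. Qed.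

Lemma flatten_is_concat (SI : finType) f (u : nat -> seq SI) alpha i :
  is_concat f u alpha -> flatten (mkseq u i) = mkseq alpha (\sum_(j < i) f j).
Proof.
move=> uE; elim: i => [|i IH]; first by rewrite big_ord0.
by rewrite -addn1 mkseqD flatten_cat IH /= cats0 addn0 uE addn1 big_ord_recr /= mkseqD.
Qed.

Definition long_first (D i : nat) : nat := if i is 0 then D else 1.

Lemma sum_long_first D i : \sum_(j < i.+1) long_first D j = D + i.
Proof.
by rewrite big_ord_recl /= sum_nat_const card_ord muln1.
Qed.

Definition numbers n (x : nat -> bool) (m : nat) : nat :=
  num (fun c => x (m * 2 ^ n.+1 + c)) (2 ^ n).

(** The first round shows [M] complete periods, enough for a bad pair, and O spells its number
    forever. Either I is on time throughout and the comparing run accepts, or the first wrong letter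
    is a challenge or a clock error. *)
Lemma O_wins_aut n : 0 < n ->
  O_wins (long_first (2 ^ 2 ^ 2 ^ n * 2 ^ n.+1)) (lang (aut n)).
Proof.
move=> n0; set M := 2 ^ _; set D := M * _.
have P2 := exp2S n; have n2 := ltn_expl n (ltnSn 1).
pose dec (s : seq (letterI n)) := numbers n (nth false [seq a.1.2 | a <- s]).
have [J JP] : exists J : seq (letterI n) -> nat, forall s, exists p q,
    [/\ q < M, bad_pair (dec s) p q & dec s p = J s].
  apply: (functional_choice (fun s x => exists p q,
    [/\ q < M, bad_pair (dec s) p q & dec s p = x])) => s.
  have [m _|p [q [_ qM bp]]] := @bad_pair_exists (dec s) (2 ^ 2 ^ n) 0.
    exact: num_lt.
  by exists (dec s p), p, q.
(* In round [i] Player O has seen [D + i] letters, so [size s - D] is the round; [take D] keeps the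
   choice of [J] fixed. *)
exists (fun s => bit (J (take D s)) ((size s - D) %% 2 ^ n.+1)).
move=> u v _ cons alpha uE; pose s0 := mkseq alpha D; pose j := J s0.
have vE i : v i = bit j (i %% 2 ^ n.+1).
  rewrite cons (flatten_is_concat _ uE) sum_long_first size_mkseq addKn.
  by rewrite mkseqD take_cat size_mkseq ltnn subnn take0 cats0.
set w := fun k => _; apply/lang_autP.
have [p [q [qM bp jE]]] := JP s0; rewrite -/j in jE.
case: (classic (exists t, ~~ on_time w t)) => [ex|nex].
  have [t0 nt0 mint0] := ex_minnP ex.
  have ok t : t < t0 -> on_time w t.
    by move=> tt0; apply: contraT => /mint0; rewrite leqNgt tt0.
  case: (boolP (challenge (w t0))) => ch.
    by apply: (accepted_challenge (j := j)) ch _ => // t _; rewrite /bitO /= vE.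
  apply: (accepted_clock_error ok ch) => e.
  by move: nt0; rewrite /on_time ch e eqxx.
have ok t : on_time w t by apply: contraT => h; case: nex; exists t.
pose l := numbers n (fun t => bitI (w t)).
have decE m : m < M -> dec s0 m = l m.
  move=> mM; rewrite /dec /l /numbers.
  have h c : c < 2 ^ n -> nth false [seq a.1.2 | a <- s0] (m * 2 ^ n.+1 + c)
      = bitI (w (m * 2 ^ n.+1 + c)).
    move=> cn; have h : m * 2 ^ n.+1 + c < D.
      have : m.+1 * 2 ^ n.+1 <= D by rewrite leq_mul2r mM orbT.
      by rewrite mulSnr; lia.
    by rewrite (nth_map (alpha 0)) ?size_mkseq // nth_mkseq.
  apply: (@bit_inj (2 ^ n)); rewrite ?num_lt // => i ltin.
  by rewrite !bit_num // h.
have [pq epq le] := bp.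
have bl : bad_pair l p q.
  split=> //; first by rewrite -!decE //; apply: ltn_trans qM.
  move=> k /andP [pk kq]; rewrite -!decE; try by lia.
  by apply: le; rewrite pk.
have := pair_scan_complete bl; rewrite -decE ?(ltn_trans pq) // jE => sc.
apply: (@accepted_cmp_run _ _ (q.+1 * 2 ^ n.+1)); first by move=> t; case/andP: (ok t).
rewrite (@cmp_run_scan n w l j) ?sc //.
- by move=> t; have /andP [_ /eqP] := ok t.
- by move=> m c cn; rewrite /l bit_num.
- by move=> m c cn; rewrite /bitO /= vE period_mod //; lia.
- by move=> m; apply: num_lt.
- by rewrite -jE; apply: num_lt.
Qed.

(** * Player I wins with small lookahead *)

Lemma leq_sum_delay (g : nat -> nat) a b : a <= b -> \sum_(i < a) g i <= \sum_(i < b) g i.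
Proof. by move=> /subnKC <-; rewrite big_split_ord leq_addr. Qed.

Lemma delay_sum_ge (g : nat -> nat) i : delay_fun g -> i <= \sum_(j < i) g j.
Proof.
move=> gpos; elim: i => [|i IH] //; rewrite big_ord_recr /=.
by rewrite -addn1 leq_add // gpos.
Qed.

Lemma delay_block (g : nat -> nat) t : delay_fun g ->
  exists i, \sum_(j < i) g j <= t < \sum_(j < i.+1) g j.
Proof.
move=> gpos; elim: t => [|t [i /andP [it ti]]].
  by exists 0; rewrite big_ord0 big_ord_recr big_ord0 /= add0n gpos.
have [h|h] := ltnP t.+1 (\sum_(j < i.+1) g j).
  by exists i; rewrite h (leq_trans it).
exists i.+1; rewrite h big_ord_recr /=.
by rewrite -addn1 leq_add // gpos.
Qed.

Definition deviates n (v : nat -> bool) (t : nat) : bool :=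
  (t %% 2 ^ n.+1 < 2 ^ n) && (v t != v (t %% 2 ^ n.+1)).

Definition clock_letter n (t : nat) : 'I_(2 ^ n.+1) :=
  Ordinal (ltn_pmod t (expn_gt0 2 n.+1 : 0 < 2 ^ n.+1)).

(* The letter at position [t], if Player O has played [v 0], ..., [v i.-1].
   Deviations of O only count once their period is complete: before that, an
   accepting run may still postpone the choice of its address. *)
Definition move_I n (v : nat -> bool) (i t : nat) : letterI n :=
  let s := iota 0 (i %/ 2 ^ n.+1 * 2 ^ n.+1) in
  if has (deviates n v) s then
    (true, false, clock_letter n (find (deviates n v) s))
  else
    (false,
     if t < (2 ^ 2 ^ 2 ^ n).-1 * 2 ^ n.+1
     then bit (ruler (t %/ 2 ^ n.+1)) (t %% 2 ^ n.+1) else ~~ v (t %% 2 ^ n.+1),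
     clock_letter n t).

(** The history suffices: deviations are sought in complete periods only, and O's number is
    consulted only beyond the ruler sequence, where the hypothesis makes the first period of O
    known. *)
Lemma move_I_mkseq n v i t :
  ((2 ^ 2 ^ 2 ^ n).-1 * 2 ^ n.+1 <= t -> 2 ^ n.+1 <= i) ->
  move_I n (nth false (mkseq v i)) i t = move_I n v i t.
Proof.
move=> ti; rewrite /move_I.
have e : {in iota 0 (i %/ 2 ^ n.+1 * 2 ^ n.+1),
    deviates n (nth false (mkseq v i)) =1 deviates n v}.
  move=> s; rewrite mem_iota add0n => /andP [_ /leq_trans /(_ (leq_trunc_div _ _)) si].
  by rewrite /deviates !nth_mkseq //; apply: leq_ltn_trans (leq_mod _ _) si.
rewrite (eq_in_has e) (eq_in_find e); case: has => //.
case: ltnP => // /ti h; rewrite nth_mkseq //.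
by apply: leq_trans h; rewrite ltn_pmod // expn_gt0.
Qed.

Definition strat_I n (g : nat -> nat) (s : seq bool) : seq (letterI n) :=
  mkseq (fun m => move_I n (nth false s) (size s) (\sum_(j < size s) g j + m)) (g (size s)).

Lemma strat_I_play n g (u : nat -> seq (letterI n)) v alpha t :
  delay_fun g -> \sum_(j < 2 ^ n.+1) g j <= (2 ^ 2 ^ 2 ^ n).-1 * 2 ^ n.+1 ->
  consistentI (strat_I n g) u v -> is_concat g u alpha ->
  exists i, [/\ \sum_(j < i) g j <= t < \sum_(j < i.+1) g j & alpha t = move_I n v i t].
Proof.
move=> gpos gP cons uE; have [i it] := delay_block t gpos; exists i; split=> //.
case/andP: it => it ti; pose m := t - \sum_(j < i) g j.
have tE : t = \sum_(j < i) g j + m by rewrite subnKC.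
have mg : m < g i by move: ti; rewrite big_ord_recr /= {1}tE ltn_add2l.
have := congr1 (fun s => nth (alpha 0) s m) (etrans (esym (uE i)) (cons i)).
rewrite /strat_I size_mkseq !nth_mkseq // -tE => ->; apply: move_I_mkseq => ht.
(* All letters given in rounds before [2 ^ n.+1] still belong to the ruler sequence. *)
rewrite leqNgt; apply/negP => iP.
have := leq_trans ti (leq_sum_delay g iP); lia.
Qed.

Lemma I_wins_aut n g : 0 < n -> delay_fun g ->
  \sum_(j < 2 ^ n.+1) g j <= (2 ^ 2 ^ 2 ^ n).-1 * 2 ^ n.+1 ->
  I_wins g (lang (aut n)).
Proof.
move=> n0 gpos gP; exists (strat_I n g); split; first by move=> s; rewrite size_mkseq.
move=> u v _ cons alpha uE; set w := fun k => _.
move=> /lang_autP [rho [pth ac]].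
have P2 := exp2S n; have n2 := ltn_expl n (ltnSn 1).
have P0 : 0 < 2 ^ n.+1 by rewrite expn_gt0.
have play t := strat_I_play t gpos gP cons uE.
(* If O deviates, I's challenge rules out each of the three ways to accept. *)
have nodev t : ~~ deviates n v t.
  apply/negP => dt.
  have [tau dtau mintau] := ex_minnP (ex_intro (fun t => deviates n v t) t dt).
  (* Round [K] is the first in which I knows the whole period of the first deviation [tau]; her
     challenge therefore starts at position [T]. *)
  pose K := (tau %/ 2 ^ n.+1).+1 * 2 ^ n.+1; pose T := \sum_(j < K) g j.
  pose a := tau %% 2 ^ n.+1.
  have [an dev] := andP dtau.
  have KE i : (tau < i %/ 2 ^ n.+1 * 2 ^ n.+1) = (K <= i).
    by rewrite /K -leq_divRL // -ltn_divLR.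
  have before t' : t' < T -> on_time w t'.
    move=> tT; have [i [/andP [it _] aE]] := play t'.
    have iK : i < K.
      by rewrite ltnNge; apply/negP => /(leq_sum_delay g); rewrite -/T; lia.
    rewrite /on_time /challenge /clock /w /= aE /move_I ifF ?eqxx //.
    apply/hasPn => s; rewrite mem_iota add0n => /andP [_ si].
    apply/negP => /mintau h; have := leq_ltn_trans h si; rewrite KE; lia.
  have after t' : T <= t' -> challenge (w t') /\ clock (w t') = a.
    move=> tT; have [i [/andP [_ it] aE]] := play t'.
    have iK : K <= i.
      by rewrite leqNgt; apply/negP => /(leq_sum_delay g); rewrite -/T; lia.
    have hs : has (deviates n v) (iota 0 (i %/ 2 ^ n.+1 * 2 ^ n.+1)).
      by apply/hasP; exists tau => //; rewrite mem_iota add0n KE.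
    rewrite /challenge /clock /w /= aE /move_I hs /=; split=> //.
    suff -> : find (deviates n v) (iota 0 (i %/ 2 ^ n.+1 * 2 ^ n.+1)) = tau by [].
    have fl : find (deviates n v) (iota 0 (i %/ 2 ^ n.+1 * 2 ^ n.+1)) < i %/ 2 ^ n.+1 * 2 ^ n.+1.
      by rewrite -[X in _ < X](size_iota 0) -has_find.
    apply/eqP; rewrite eqn_leq; apply/andP; split.
      rewrite leqNgt; apply/negP => h; have := before_find 0 h.
      by rewrite nth_iota ?add0n ?dtau //; apply: ltn_trans fl.
    by apply: mintau; have := nth_find 0 hs; rewrite nth_iota.
  have KT : K <= T by apply: delay_sum_ge.
  case: ac => [h|[h|[h ncl]]].
  - have [nc _] := run_Done pth h.
    by have := nc T; have [-> _] := after T (leqnn T).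
  - apply: (run_Err _ pth h) => t' nc.
    have [/before /andP [_ /eqP] //|tT] := ltnP t' T.
    by have := nc t' (leqnn _); have [-> _] := after t' tT.
  (* As [K <= T], both the first period and that of [tau] end before the challenge, so O's bits at
     [a] and [tau] agree. *)
  - have [r rP] := run_Fin n0 an before after pth h ncl.
    have := rP 0; have := rP (tau %/ 2 ^ n.+1) KT.
    rewrite mul0n add0n mul1n /bitO /w /= -divn_eq => e1 e2.
    case/negP: dev; rewrite e1 e2 //; apply: leq_trans KT.
    by rewrite /K leq_pmull.
have ok t : on_time w t.
  have [i [_ aE]] := play t.
  rewrite /on_time /challenge /clock /w /= aE /move_I ifF ?eqxx //.
  by apply/hasPn => s _.
have ck t : clock (w t) = t %% 2 ^ n.+1 by case/andP: (ok t) => _ /eqP.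
case: ac => [h|[h|[h ncl]]].
- have [_ [t tD]] := run_Done pth h.
  pose j := num v (2 ^ n); pose j' := num (fun c => ~~ v c) (2 ^ n).
  (* Beyond the ruler sequence I spells the bitwise complement [j'] of [j], which already differs
     from [j] in bit 0. A bad pair for [j] thus lies within the ruler sequence. *)
  pose l m := if m < (2 ^ 2 ^ 2 ^ n).-1 then ruler m else j'.
  have scan : pair_scan l j t = None.
    have tP : cmp_run w (t * 2 ^ n.+1) = Done.
      by rewrite -(subnKC (leq_pmulr t P0)) cmp_run_Done.
    have bI m c : c < 2 ^ n -> bitI (w (m * 2 ^ n.+1 + c)) = bit (l m) c.
      move=> cn; have cP : c < 2 ^ n.+1 by lia.
      have [i [_ aE]] := play (m * 2 ^ n.+1 + c).
      rewrite /bitI /w /= aE /move_I ifF /=; last by apply/hasPn => s _.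
      rewrite period_mod // divnMDl // divn_small // addn0 /l.
      have -> : (m * 2 ^ n.+1 + c < (2 ^ 2 ^ 2 ^ n).-1 * 2 ^ n.+1) = (m < (2 ^ 2 ^ 2 ^ n).-1).
        by rewrite -ltn_divLR // divnMDl // divn_small // addn0.
      by case: ifP => // _; rewrite bit_num.
    have bO m c : c < 2 ^ n -> bitO (w (m * 2 ^ n.+1 + c)) = bit j c.
      move=> cn; rewrite /bitO /w /= bit_num //.
      have := nodev (m * 2 ^ n.+1 + c); rewrite /deviates period_mod; last by lia.
      by rewrite cn /= negbK => /eqP.
    have lN m : l m < 2 ^ 2 ^ n.
      by rewrite /l; case: ifP => [h'|_]; [apply: ruler_lt; lia|apply: num_lt].
    have := cmp_run_scan ck bI bO lN (num_lt _ _) t; rewrite tP.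
    by case: pair_scan.
  have [p [q [_ [pq e le] lp]]] := pair_scan_sound scan.
  have qM : q < (2 ^ 2 ^ 2 ^ n).-1.
    rewrite ltnNge; apply/negP => qM; move: e; rewrite lp /l ltnNge qM /= => /(congr1 (bit^~ 0)).
    by rewrite /= !bit_num ?expn_gt0 //; case: (v 0).
  apply: (@ruler_no_bad_pair p q); split=> //.
    by move: e; rewrite /l qM (ltn_trans pq).
  move=> k /andP [pk kq]; have := le k; rewrite pk kq /l (ltn_trans kq) ?(ltn_trans pq) //.
  by apply.
- by apply: (run_Err _ pth h) => t' _.
(* No challenge is ever made, so the run never leaves the tracking states and cannot reach [Fin]. *)
have [r r0] := run_Fin_start pth h; case: h => t e.
have : tracking r (rho t) by apply: run_tracking (proj2 pth) r0 _ => t' _; case/andP: (ok t').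
by rewrite e.
Qed.

(** * The size bound and the arithmetic of the delay bounds *)

Theorem theorem5 :
  exists c : nat, forall n : nat, 1 <= n ->
    exists (SI SO : finType) (A : wm_automaton (prod SI SO)),
      aut_size A <= c * n ^ 3 /\
      (exists f, delay_fun f /\ constant_delay f /\ O_wins f (lang A)) /\
      (forall g, delay_fun g ->
         \sum_(0 <= i < ((n + 2) * 2 ^ n).+1) g i <= 2 ^ (2 ^ (2 ^ n)) ->
         I_wins g (lang A)).
Proof.
(* The constant is 21 + 24, from the linear bound [aut_size_le] and [1 <= n]. *)
exists 45 => n n1; exists (letterI n), bool, (aut n); split; [|split].
- apply: leq_trans (aut_size_le n) _.
  have : n ^ 1 <= n ^ 3 by rewrite leq_pexp2l.
  by rewrite expn1; lia.
- exists (long_first (2 ^ 2 ^ 2 ^ n * 2 ^ n.+1)); split; [|split].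
  + by case=> [|i] //=; rewrite muln_gt0 !expn_gt0.
  + by case.
  + exact: O_wins_aut.
move=> g gpos; rewrite big_mkord => gM; apply: I_wins_aut => //.
have P2 := exp2S n; have n2 := ltn_expl n (ltnSn 1).
(* The first [2 ^ n.+1] rounds are among those bounded by the hypothesis. With [M = 2 ^ 2 ^ 2 ^ n],
   it remains to see that [M <= M.-1 * 2 <= M.-1 * 2 ^ n.+1]. *)
apply: leq_trans (leq_trans (leq_sum_delay g _) gM) _.
  by rewrite exp2S mulnDl; lia.
have : 2 <= 2 ^ 2 ^ 2 ^ n by rewrite -[leqLHS]expn1 leq_pexp2l // expn_gt0.
have : (2 ^ 2 ^ 2 ^ n).-1 * 2 <= (2 ^ 2 ^ 2 ^ n).-1 * 2 ^ n.+1.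
  by apply: leq_mul => //; lia.
by move: (_.-1 * 2 ^ n.+1) => k; lia.
Qed.
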